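(* Let $P(\lambda)$ be a regular $n\times n$ complex matrix polynomial, $\Gamma$ a closed contour in the complex plane, and $u,v$ arbitrarily given vectors in $\mathbb{C}^n$. Suppose that $P(\lambda)$ has exactly $m$ eigenvalues in the interior of $\Gamma$, namely, distinct eigenvalues $\lambda_0,\ldots,\lambda_s$ with algebraic multiplicities $m_0,\ldots,m_s$, respectively, such that $m=m_0+\cdots+m_s$. Moreover, assume that no eigenvalue of $P(\lambda)$ lies exactly on the contour $\Gamma$. If the geometric multiplicity of $\lambda_i$ is equal to one for every $i=0,\ldots,s$, then the $m\times m$ Hankel matrix $H_0$ is nonsingular and the eigenvalues of the pencil $H_1-\lambda H_0$ are given by $\lambda_0,\ldots,\lambda_s$ with algebraic multiplicities $m_0,\ldots,m_s$.
   Context: $P(\lambda)=\sum_{j=0}^\ell A_j\lambda^j$, with $A_j\in\mathbb{C}^{n\times n}$ and $A_\ell\ne0$, is regular if $\det P(\lambda)$ does not vanish identically. The algebraic multiplicity of an eigenvalue $\lambda_0$ of $P(\lambda)$ is its multiplicity as a root of $\det P(\lambda)$; its geometric multiplicity is the dimension of the null space of $P(\lambda_0)$. Define $$f(z)=u^HP(z)^{-1}v,\qquad \mu_k=\frac{1}{2\pi\imath}\oint_\Gamma z^kf(z)\,dz\quad(k=0,1,2,\ldots),$$ and the $m\times m$ Hankel matrices $H_0=[\mu_{i+j}]_{i,j=0}^{m-1}$, $H_1=[\mu_{i+j+1}]_{i,j=0}^{m-1}$.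
   Formalization: The vectors u, v are not arbitrary (u = 0 gives H_0 = 0): it is assumed that, for each enclosed eigenvalue λ_i, u is not orthogonal to any right eigenvector and v is not orthogonal to any left eigenvector, a condition also necessary for H_0 to be nonsingular. *)

(* Defs.v *)
(* MathComp / MathComp-Analysis.  The complex numbers are R[i] for an arbitrary
   R : realType. *)
From HB Require Import structures.
From mathcomp Require Import all_boot all_order all_algebra.
From mathcomp Require Import spectral complex.
From mathcomp Require Import all_classical all_reals all_analysis.

Set Implicit Arguments.
Unset Strict Implicit.
Unset Printing Implicit Defensive.

Import Order.TTheory GRing.Theory Num.Theory.
Import numFieldNormedType.Exports.

Local Open Scope classical_set_scope.
Local Open Scope ring_scope.
Local Open Scope complex_scope.
Local Open Scope sesquilinear_scope.

Section MatrixPolynomial.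
Variables (R : realType) (n : nat).
Local Notation C := R[i].

(* The matrix polynomial P(X) = \sum_(j <= l) A j X^j is given by its
   coefficient family A. It is seen as a matrix with polynomial entries, which
   also makes sense for n = 0. *)
Definition mxpol (l : nat) (A : 'I_l.+1 -> 'M[C]_n) : 'M[{poly C}]_n :=
  \sum_(j < l.+1) 'X^j *: map_mx polyC (A j).

Definition mxpol_eval (l : nat) (A : 'I_l.+1 -> 'M[C]_n) (z : C) : 'M[C]_n :=
  \sum_(j < l.+1) z ^+ j *: A j.

Definition mxpol_regular (l : nat) (A : 'I_l.+1 -> 'M[C]_n) : Prop :=
  \det (mxpol A) != 0.

Definition mxpol_eigenvalue (l : nat) (A : 'I_l.+1 -> 'M[C]_n) (z : C) : Prop :=
  root (\det (mxpol A)) z.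

Definition alg_mult (l : nat) (A : 'I_l.+1 -> 'M[C]_n) (z : C) : nat :=
  mup z (\det (mxpol A)).

(* kermx is the left kernel, hence the transpose. *)
Definition geom_mult (l : nat) (A : 'I_l.+1 -> 'M[C]_n) (z : C) : nat :=
  \rank (kermx (mxpol_eval A z)^T).

(* The pencil H1 - X H0. *)
Definition pencil (H1 H0 : 'M[C]_n) : 'I_2 -> 'M[C]_n :=
  fun j => if j == ord0 then H1 else - H0.

(* Genericity of the pair (u, v) with respect to the eigenvalue z: u is not
   orthogonal to any right eigenvector, and v is not orthogonal to any left
   eigenvector. *)
Definition generic_at (l : nat) (A : 'I_l.+1 -> 'M[C]_n) (u v : 'cV[C]_n)
    (z : C) : Prop :=
  (forall x : 'cV[C]_n, x != 0 -> mxpol_eval A z *m x = 0 -> u^t* *m x != 0) /\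
  (forall y : 'cV[C]_n, y != 0 -> y^t* *m mxpol_eval A z = 0 -> y^t* *m v != 0).

(* When z has geometric multiplicity one, generic_at excludes exactly one
   hyperplane for u and one for v. *)
Lemma generic_atP (l : nat) (A : 'I_l.+1 -> 'M[C]_n) (z : C) :
  geom_mult A z = 1%N ->
  exists x y : 'cV[C]_n, [/\ x != 0, y != 0 & forall u v : 'cV[C]_n,
    generic_at A u v z <-> u^t* *m x != 0 /\ y^t* *m v != 0].
Proof.
set M := mxpol_eval A z => hz.
have line (N : 'M[C]_n) : \rank (kermx N) = 1%N -> exists w : 'rV[C]_n,
    [/\ w != 0, w *m N = 0 &
        forall w' : 'rV_n, w' *m N = 0 -> exists a, w' = a *: w].
  move=> r1; have : kermx N != 0 by rewrite -mxrank_eq0 r1.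
  case/rowV0Pn=> w wK w0; exists w; split => //; first exact/sub_kermxP.
  move=> w' /sub_kermxP w'K; apply/sub_rVP; apply: submx_trans w'K _.
  by rewrite -(geq_leqif (mxrank_leqif_sup wK)) r1 rank_rV w0.
have hz' : \rank (kermx M) = 1%N by move: hz; rewrite /geom_mult !mxrank_ker mxrank_tr.
have [wx [wx0 wxM wxP]] := line _ hz.
have [wy [wy0 wyM wyP]] := line _ hz'.
exists wx^T, (wy^t*); split.
- by rewrite -(inj_eq (can_inj (@trmxK _ _ _))) trmxK trmx0.
- by apply: contra_neq wy0 => e; rewrite -[wy]trmxCK e trmx0 map_mx0.
move=> u v; split=> [[hu hv]|[hu hv]].
  split; first apply: hu.
  - by rewrite -(inj_eq (can_inj (@trmxK _ _ _))) trmxK trmx0.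
  - by apply: trmx_inj; rewrite trmx_mul trmxK trmx0.
  apply: hv; last by rewrite trmxCK.
  by apply: contra_neq wy0 => e; rewrite -[wy]trmxCK e trmx0 map_mx0.
split=> [x x0 xM|y y0 yM].
  have [|a xa] := wxP x^T; first by rewrite -trmx_mul xM trmx0.
  have {}xa : x = a *: wx^T by rewrite -[x]trmxK xa linearZ.
  rewrite xa -scalemxAr scaler_eq0 negb_or hu andbT.
  by apply: contra_neq x0 => a0; rewrite xa a0 scale0r.
have [a ya] := wyP _ yM.
rewrite ya -scalemxAl scaler_eq0 negb_or; apply/andP; split.
  apply: contra_neq y0 => a0; move: ya; rewrite a0 scale0r => e.
  by rewrite -[y]trmxCK e trmx0 map_mx0.
by move: hv; rewrite trmxCK.
Qed.

End MatrixPolynomial.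

Section Contour.
Variable R : realType.
Local Notation C := R[i].

(* Continuously differentiable on [0, 1], with one-sided derivatives at the
   endpoints: the derivative on ]0, 1[ extends continuously to [0, 1]. *)
Definition C1_on01 (x : R -> R) : Prop :=
  {within `[0, 1], continuous x} /\
  exists2 dx : R -> R, {within `[0, 1], continuous dx} &
    forall t : R, t \in `]0, 1[ -> is_derive t 1 x (dx t).

Definition C1_arc (g : R -> C) : Prop :=
  C1_on01 (fun t => complex.Re (g t)) /\ C1_on01 (fun t => complex.Im (g t)).

(* A contour is a finite chain of C^1 arcs parametrized by [0, 1]; it is closed
   when each arc ends where the (cyclically) next one starts. Neither simplicity
   nor an orientation is imposed. *)
Definition closed_contour (G : seq (R -> C)) : Prop :=
  (forall g, g \in G -> C1_arc g) /\ cycle (fun g h => g 1 == h 0) G.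

Definition on_contour (G : seq (R -> C)) (z : C) : Prop :=
  exists2 g, g \in G & exists2 t : R, t \in `[0, 1] & g t = z.

Definition cintegral01 (h : R -> C) : C :=
  Rintegral lebesgue_measure `[0, 1] (fun t => complex.Re (h t)) +i*
  Rintegral lebesgue_measure `[0, 1] (fun t => complex.Im (h t)).

(* The values of derive1 at t = 0 and t = 1, where g need not be derivable
   (two-sidedly), do not affect the integral. *)
Definition arc_deriv (g : R -> C) (t : R) : C :=
  derive1 (fun s => complex.Re (g s)) t +i* derive1 (fun s => complex.Im (g s)) t.

Definition contour_integral (G : seq (R -> C)) (h : C -> C) : C :=
  \sum_(g <- G) cintegral01 (fun t => h (g t) * arc_deriv g t).

Definition two_pi_i : C := (2 * pi)%:C * 'i.

Definition winding_number (G : seq (R -> C)) (z : C) : C :=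
  two_pi_i^-1 * contour_integral G (fun w => (w - z)^-1).

(* The points enclosed by a closed contour. For a simple closed contour, of
   either orientation, this is the bounded component of its complement. *)
Definition inside (G : seq (R -> C)) (z : C) : Prop :=
  ~ on_contour G z /\ winding_number G z != 0.

End Contour.

Section Moments.
Variables (R : realType) (n l : nat) (A : 'I_l.+1 -> 'M[R[i]]_n).
Variables (u v : 'cV[R[i]]_n) (G : seq (R -> R[i])).

Definition resolvent_fun (z : R[i]) : R[i] :=
  (u^t* *m invmx (mxpol_eval A z) *m v) ord0 ord0.

Definition moment (k : nat) : R[i] :=
  (two_pi_i R)^-1 * contour_integral G (fun z => z ^+ k * resolvent_fun z).

Definition hankel0 (m : nat) : 'M[R[i]]_m := \matrix_(i, j) moment (i + j).

Definition hankel1 (m : nat) : 'M[R[i]]_m := \matrix_(i, j) moment (i + j).+1.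

End Moments.

(* Main.v *)
Require Import Defs.
From HB Require Import structures.
From mathcomp Require Import all_boot all_order all_algebra.
From mathcomp Require Import spectral complex.
From mathcomp Require Import all_classical all_reals all_analysis.
From mathcomp Require Import measurable_realfun zify ring.

Set Implicit Arguments.
Unset Strict Implicit.
Unset Printing Implicit Defensive.

Import Order.TTheory GRing.Theory Num.Theory.
Import numFieldNormedType.Exports.

Local Open Scope ring_scope.

(** The function f(z) = u^* P(z)^-1 v is the rational function N / d, where d is
the determinant of P and N = u^* adj(P) v. Let D be the product of the factors
(z - lam i)^(mult i); then d = D E, where no root of E is enclosed by the
contour. All moments are values at powers of z of one linear form,
L(q) = (2 i pi)^-1 \oint q N / d, so that the theorem is about the Hankel
matrices of L.

The first point is that f has a pole of full order mult i at lam i, that is,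
N(lam i) <> 0 ([resolvent_num_neq0]). The rank-one update formula
det (P + v u^* ) = d + N, an identity between polynomials ([det_rank1_update]),
shows that N(lam i) is the determinant of P(lam i) + v u^*, and the genericity
of u and v is what makes this matrix invertible ([generic_bordered_unit]).

The second point is a residue calculus for rational functions on a closed chain
of arcs. Polynomials and poles of order at least 2 have rational primitives, so
only simple poles contribute, each weighted by its winding number, which off the
contour is nonzero exactly at the enclosed points. In particular a rational
function without enclosed poles or poles on the contour integrates to 0
([ratio_integral_outside]).

It follows that L vanishes on the multiples of D. Conversely, if q is not a
multiple of D, there is p such that q p f has exactly one enclosed pole, which
is simple, and L(q p) <> 0 ([ratio_integral_nondegenerate]). So the bilinear
form (q, p) |-> L(q p) is nondegenerate on polynomials modulo D. Its Gram matrix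
in the basis 1, z, ..., z^(m-1) is H0, which is therefore invertible
([hankel_unit]). Multiplication by z in this quotient is given by the companion
matrix of D, hence H1 is this companion matrix times H0 ([hankel_shift]), and
the determinant of the pencil is D up to a nonzero constant
([det_hankel_pencil]). *)

(** * Polynomials in one variable *)

Section Polynomials.

Lemma rVpoly_sum (F : fieldType) d (w : 'rV[F]_d) :
  rVpoly w = \sum_(i < d) w 0 i *: 'X^i.
Proof. by rewrite /rVpoly poly_def; apply: eq_bigr => i _; rewrite valK. Qed.

Lemma poly_primitive (F : numFieldType) (q : {poly F}) : exists p, p^`() = q.
Proof.
exists (\poly_(i < (size q).+1) (q`_i.-1 / i%:R)).
apply/polyP => i; rewrite coef_deriv coef_poly ltnS.
case: ltnP => [_|le_q_i]; last by rewrite mul0rn nth_default.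
by rewrite /= -[LHS]mulr_natr divfK // pnatr_eq0.
Qed.

Lemma poly_XsubC_eq (F : comNzRingType) (q : {poly F}) a :
  exists p : {poly F}, q = ('X - a%:P) * p + q.[a]%:P.
Proof.
have /factor_theorem[p e] : root (q - q.[a]%:P) a.
  by rewrite rootE !hornerE subrr.
by exists p; rewrite mulrC -e subrK.
Qed.

Lemma bezout_root (F : fieldType) (r : {poly F}) a : ~~ root r a -> forall k,
  exists u1 u2 : {poly F}, u1 * r + u2 * ('X - a%:P) ^+ k = 1.
Proof.
move=> ra k; have : coprimep r (('X - a%:P) ^+ k).
  by rewrite coprimep_expr // coprimep_XsubC.
by case/Bezout_eq1_coprimepP => [[u1 u2] /= e]; exists u1, u2.
Qed.

Lemma dvdp_prod_XsubCX (F : fieldType) (I : eqType) (lam : I -> F)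
    (mult : I -> nat) (s : seq I) (d : {poly F}) :
  injective lam -> uniq s ->
  (forall i, ('X - (lam i)%:P) ^+ mult i %| d) ->
  \prod_(i <- s) ('X - (lam i)%:P) ^+ mult i %| d.
Proof.
move=> inj_lam; elim: s => [|i s IHs] /=; first by rewrite big_nil dvd1p.
move=> /andP[is_ us] dd; rewrite big_cons Gauss_dvdp ?dd ?IHs //.
rewrite coprimep_expl // coprimep_sym coprimep_XsubC rootE horner_prod.
rewrite prodf_seq_neq0; apply/allP => j js /=.
rewrite horner_exp hornerXsubC expf_neq0 // subr_eq0 (inj_eq inj_lam).
by apply: contraNneq is_ => ->.
Qed.

Lemma mup_prod_XsubCX (F : fieldType) (I : finType) (lam : I -> F)
    (mult : I -> nat) i : injective lam ->
  mup (lam i) (\prod_j ('X - (lam j)%:P) ^+ mult j) = mult i.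
Proof.
move=> inj_lam; rewrite (bigD1 i) //= mupMl ?mup_XsubCX ?eqxx //.
rewrite rootE horner_prod; apply/prodf_neq0 => j ji.
by rewrite horner_exp hornerXsubC expf_neq0 // subr_eq0 (inj_eq inj_lam) eq_sym.
Qed.

End Polynomials.

(** * A rank-one update of the determinant *)

(** Both sides are determinants of the bordered matrix [[1, -r], [c, M]]: the
left one is its Schur complement at the corner 1, and the right one appears,
up to the factor [\det M], when [\adj M] clears the column [c]. Hence the
cancellation hypothesis on [\det M]. It may hold over polynomials while failing
after evaluation, and then the formula survives for the singular matrix. *)
Lemma det_rank1_update (T : idomainType) n (M : 'M[T]_n) (c : 'cV_n) (r : 'rV_n) :
  \det M != 0 ->
  \det (M + c *m r) = \det M + (r *m \adj M *m c) 0 0.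
Proof.
move=> dM; pose B := block_mx (1%:M : 'M[T]_1) (- r) c M.
have detB : \det B = \det (M + c *m r).
  (* U is the elementary block matrix that clears the column c of B. *)
  pose U : 'M[T]_(1 + n) := block_mx 1%:M 0 (- c) 1%:M.
  have detU : \det U = 1 by rewrite det_lblock !det1 mulr1.
  rewrite -[LHS]mul1r -detU -det_mulmx mulmx_block !mul1mx !mul0mx !addr0 mulmx1 addNr.
  by rewrite mulNmx mulmxN opprK det_ublock det1 mul1r addrC.
apply: (mulIf dM); rewrite -detB.
pose V : 'M[T]_(1 + n) := block_mx (\det M)%:M 0 (- (\adj M *m c)) 1%:M.
have detV : \det V = \det M by rewrite det_lblock det_scalar1 det1 mulr1.
rewrite -{1}detV -det_mulmx mulmx_block mul1mx mulmx0 add0r mulmx0 add0r !mulmx1.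
rewrite mulmxN mulNmx opprK mulmxN [M *m _]mulmxA mul_mx_adj mul_scalar_mx mul_mx_scalar.
by rewrite subrr det_ublock -mulmxA det_mx11 mxE [_%:M 0 0]mxE mulr1n.
Qed.

(** * Hankel pencils of linear forms on polynomials *)

Section HankelPencil.
Variables (F : fieldType) (L : {scalar {poly F}}) (D : {poly F}).
Hypothesis monicD : D \is monic.
Local Notation m := (size D).-1.
Let H0 : 'M[F]_m := \matrix_(i, j) L 'X^(i + j).
Let H1 : 'M[F]_m := \matrix_(i, j) L 'X^((i + j).+1).

Hypothesis LD0 : forall p, L (D * p) = 0.

Let sizeD : size D = m.+1.
Proof. by rewrite prednK // size_poly_gt0 monic_neq0. Qed.

(** A kernel vector of H0 is a polynomial q of size at most m with
L (q * 'X^j) = 0 for j < m. As L vanishes on the multiples of D, reduction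
modulo D extends this to L (q * p) = 0 for every p. *)
Lemma hankel_unit :
  (forall q : {poly F}, q != 0 -> (size q <= m)%N -> exists p, L (q * p) != 0) ->
  H0 \in unitmx.
Proof.
move=> nondeg; rewrite -row_free_unit -kermx_eq0.
apply/rowV0P => w /sub_kermxP wH0; apply/eqP/contraT => w0.
have q0 : rVpoly w != 0.
  by apply: contra_neq w0 => /(congr1 (@poly_rV F m)); rewrite rVpolyK linear0.
have [p /eqP[]] := nondeg _ q0 (size_poly _ _).
rewrite (divp_eq p D) mulrDr linearD /= [_ * D]mulrC mulrCA LD0 add0r.
have lt_rm : (size (p %% D)%R <= m)%N.
  by rewrite -ltnS -sizeD ltn_modp monic_neq0.
rewrite -(poly_rV_K lt_rm) !rVpoly_sum mulr_suml linear_sum /=.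
under eq_bigr => i _ do rewrite mulr_sumr linear_sum /=.
rewrite exchange_big big1 //= => j _.
have := congr1 (fun M : 'rV_m => M 0 j) wH0; rewrite !mxE => wj.
rewrite -[RHS](mulr0 (p %% D)`_j) -[X in _ = _ * X]wj mulr_sumr.
apply: eq_bigr => i _; rewrite -scalerAl -scalerAr !linearZ /= !mxE -exprD.
by rewrite mulrCA.
Qed.

(** Multiplication by 'X modulo D has a companion matrix, and L factors through
the quotient by D. *)
Lemma hankel_shift : H1 = companionmx D *m H0.
Proof.
apply/matrixP => i j; rewrite !mxE.
have [im|im] := eqVneq (i : nat) m.-1; last first.
  have im' : (i.+1 < m)%N by have := ltn_ord i; lia.
  rewrite (bigD1 (Ordinal im')) //= big1 => [|k ki].
    by rewrite !mxE (negPf im) eqxx mul1r addr0 addSn.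
  rewrite !mxE (negPf im) [_ == _]negbTE ?mul0r //.
  by apply: contraNneq ki => e; apply/eqP/val_inj.
have DE : D = \sum_(k < m) D`_k *: 'X^k + 'X^m.
  rewrite -[LHS]coefK [X in \poly_(_ < X) _]sizeD poly_def big_ord_recr /=.
  by rewrite -[D`_m]/(lead_coef D) (monicP monicD) scale1r.
have := LD0 'X^j; rewrite {1}DE mulrDl linearD /= mulr_suml linear_sum /=.
rewrite -exprD => /eqP; rewrite addrC addr_eq0 => /eqP LDm.
have -> : (i + j).+1 = (m + j)%N by have := ltn_ord i; lia.
rewrite LDm -sumrN; apply: eq_bigr => k _.
by rewrite !mxE im eqxx -scalerAl linearZ /= -exprD mulNr.
Qed.

Lemma det_hankel_pencil :
  \det (map_mx polyC H1 - 'X *: map_mx polyC H0) = ((-1) ^+ m * \det H0) *: D.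
Proof.
rewrite hankel_shift map_mxM -mul_scalar_mx -mulmxBl det_mulmx det_map_mx.
rewrite -opprB -scaleN1r detZ -[\det (_ - _)]/(char_poly _) companionmxK //.
by rewrite -mul_polyC polyCM rmorphXn rmorphN1 mulrAC.
Qed.

End HankelPencil.

(** * Calculus of complex functions on [0, 1] *)

Section ComplexValued.
Local Open Scope classical_set_scope.
Local Open Scope ring_scope.
Variable R : realType.
Local Notation C := R[i].
Local Notation Re := complex.Re.
Local Notation Im := complex.Im.
Implicit Types (f g h : R -> C) (t : R) (c : C).

(** Continuity and derivatives of complex functions of a real variable are taken
componentwise, as contour integrals are. *)
Definition ccont01 f :=
  {within `[0, 1], continuous (fun t => Re (f t))} /\
  {within `[0, 1], continuous (fun t => Im (f t))}.

Definition is_cderive f t c :=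
  is_derive t 1 (fun t => Re (f t)) (Re c) /\
  is_derive t 1 (fun t => Im (f t)) (Im c).

Lemma ReD (x y : C) : Re (x + y) = Re x + Re y.
Proof. by case: x; case: y. Qed.

Lemma ImD (x y : C) : Im (x + y) = Im x + Im y.
Proof. by case: x; case: y. Qed.

Lemma ReN (x : C) : Re (- x) = - Re x.
Proof. by case: x. Qed.

Lemma ImN (x : C) : Im (- x) = - Im x.
Proof. by case: x. Qed.

Lemma ReM (x y : C) : Re (x * y) = Re x * Re y - Im x * Im y.
Proof. by case: x => a b; case: y. Qed.

Lemma ImM (x y : C) : Im (x * y) = Re x * Im y + Im x * Re y.
Proof. by case: x => a b; case: y. Qed.

Lemma ReV (x : C) : Re x^-1 = Re x / (Re x * Re x + Im x * Im x).
Proof. by case: x. Qed.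

Lemma ImV (x : C) : Im x^-1 = - (Im x / (Re x * Re x + Im x * Im x)).
Proof. by case: x. Qed.

Lemma sqr_norm_neq0 (x : C) : x != 0 -> Re x * Re x + Im x * Im x != 0.
Proof.
case: x => a b; rewrite eq_complex /= -!expr2 negb_and => ab0.
by rewrite paddr_eq0 ?sqr_ge0// !sqrf_eq0 negb_and.
Qed.

Lemma eq_ccont01 f g : f =1 g -> ccont01 f -> ccont01 g.
Proof. by move=> /funext ->. Qed.

Lemma ccont01_cst c : ccont01 (fun=> c).
Proof. by split=> x; exact: cvg_cst. Qed.

Lemma ccont01D f g : ccont01 f -> ccont01 g -> ccont01 (fun t => f t + g t).
Proof.
move=> [fr fi] [gr gi]; split.
  by rewrite (_ : (fun _ => _) = (fun t => Re (f t) + Re (g t)));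
    [move=> x; apply: cvgD; [exact: fr|exact: gr]
    |apply/funext => t; rewrite raddfD].
by rewrite (_ : (fun _ => _) = (fun t => Im (f t) + Im (g t)));
  [move=> x; apply: cvgD; [exact: fi|exact: gi]
  |apply/funext => t; rewrite raddfD].
Qed.

Lemma ccont01M f g : ccont01 f -> ccont01 g -> ccont01 (fun t => f t * g t).
Proof.
move=> [fr fi] [gr gi]; split.
  rewrite (_ : (fun _ => _) =
    (fun t => Re (f t) * Re (g t) - Im (f t) * Im (g t))); last first.
    by apply/funext => t; rewrite ReM.
  by move=> x; apply: cvgB; apply: cvgM;
    [exact: fr|exact: gr|exact: fi|exact: gi].
rewrite (_ : (fun _ => _) =
  (fun t => Re (f t) * Im (g t) + Im (f t) * Re (g t))); last first.
  by apply/funext => t; rewrite ImM.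
by move=> x; apply: cvgD; apply: cvgM;
  [exact: fr|exact: gi|exact: fi|exact: gr].
Qed.

Lemma within01_cvgV (n : R -> R) : (forall t, t \in `[0, 1] -> n t != 0) ->
  {within `[0, 1], continuous n} -> {within `[0, 1], continuous (fun t => (n t)^-1)}.
Proof.
move=> n0 nc; rewrite continuous_subspace_in => t t01.
by apply: cvgV; [apply: n0; exact: (set_mem t01)|exact: nc].
Qed.

Lemma ccont01V f : (forall t, t \in `[0, 1] -> f t != 0) -> ccont01 f ->
  ccont01 (fun t => (f t)^-1).
Proof.
move=> f0 [fr fi].
have nV : {within `[0, 1],
    continuous (fun t => (Re (f t) * Re (f t) + Im (f t) * Im (f t))^-1)}.
  apply: within01_cvgV => [t /f0 /sqr_norm_neq0//|x].
  by apply: cvgD; apply: cvgM; do ?[exact: fr|exact: fi].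
split.
  rewrite (_ : (fun _ => _) = (fun t => Re (f t) *
    (Re (f t) * Re (f t) + Im (f t) * Im (f t))^-1)); last first.
    by apply/funext => t; rewrite ReV.
  by move=> x; apply: cvgM; [exact: fr|exact: nV].
rewrite (_ : (fun _ => _) = (fun t => - (Im (f t) *
  (Re (f t) * Re (f t) + Im (f t) * Im (f t))^-1))); last first.
  by apply/funext => t; rewrite ImV.
by move=> x; apply: cvgN; apply: cvgM; [exact: fi|exact: nV].
Qed.

Lemma ccont01_horner (q : {poly C}) f : ccont01 f -> ccont01 (fun t => q.[f t]).
Proof.
move=> fc; elim/poly_ind: q => [|q c qc].
  by apply: eq_ccont01 (ccont01_cst 0) => t; rewrite horner0.
apply: eq_ccont01 (ccont01D (ccont01M qc fc) (ccont01_cst c)) => t.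
by rewrite hornerMXaddC.
Qed.

Lemma is_cderive_cst c t : is_cderive (fun=> c) t 0.
Proof. by split; exact: is_derive_cst. Qed.

Lemma is_cderiveD f g t a b : is_cderive f t a -> is_cderive g t b ->
  is_cderive (fun t => f t + g t) t (a + b).
Proof.
move=> [fr fi] [gr gi]; split.
  have := is_deriveD fr gr; rewrite -raddfD /=; congr is_derive.
  by apply/funext => s; rewrite raddfD.
have := is_deriveD fi gi; rewrite -raddfD /=; congr is_derive.
by apply/funext => s; rewrite raddfD.
Qed.

Lemma is_cderiveM f g t a b : is_cderive f t a -> is_cderive g t b ->
  is_cderive (fun t => f t * g t) t (f t * b + a * g t).
Proof.
move=> [fr fi] [gr gi]; split.
  have := is_deriveB (is_deriveM fr gr) (is_deriveM fi gi).
  have -> : (fun s => Re (f s)) * (fun s => Re (g s)) -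
      (fun s => Im (f s)) * (fun s => Im (g s)) = (fun s => Re (f s * g s)).
    by apply/funext => s; rewrite ReM.
  move=> H; apply: (is_derive_eq H); rewrite ReD !ReM /GRing.scale /=.
  by ring.
have := is_deriveD (is_deriveM fr gi) (is_deriveM fi gr).
have -> : (fun s => Re (f s)) * (fun s => Im (g s)) +
    (fun s => Im (f s)) * (fun s => Re (g s)) = (fun s => Im (f s * g s)).
  by apply/funext => s; rewrite ImM.
move=> H; apply: (is_derive_eq H); rewrite ImD !ImM /GRing.scale /=.
by ring.
Qed.

Lemma is_cderiveV f t a : f t != 0 -> is_cderive f t a ->
  is_cderive (fun t => (f t)^-1) t (- (f t) ^- 2 * a).
Proof.
move=> f0 [fr fi]; have n0 := sqr_norm_neq0 f0.
have dn := is_deriveD (is_deriveM fr fr) (is_deriveM fi fi).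
have /= dV := is_deriveV _ dn; split.
  have := is_deriveM fr (dV n0); set F := (X in is_derive _ _ X _).
  have -> : F = (fun s => Re (f s)^-1).
    by apply/funext => s; rewrite ReV.
  move=> H; apply: (is_derive_eq H); rewrite !(ReM, ImM, ReN, ImN, ReV, ImV).
  rewrite /GRing.scale /= !fctE.
  set x := Re (f t) in n0 *; set y := Im (f t) in n0 *.
  (* |z ^ 2| ^ 2 = (|z| ^ 2) ^ 2 for z = x + i y, which leaves n0 as the only
     denominator condition. *)
  have e : (x * x - y * y) * (x * x - y * y) + (x * y + y * x) * (x * y + y * x)
      = (x * x + y * y) * (x * x + y * y) by ring.
  by rewrite e; field; rewrite n0.
have := is_deriveN (is_deriveM fi (dV n0)); set F := (X in is_derive _ _ X _).
have -> : F = (fun s => Im (f s)^-1).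
  by apply/funext => s; rewrite ImV.
move=> H; apply: (is_derive_eq H); rewrite !(ReM, ImM, ReN, ImN, ReV, ImV).
rewrite /GRing.scale /= !fctE.
set x := Re (f t) in n0 *; set y := Im (f t) in n0 *.
have e : (x * x - y * y) * (x * x - y * y) + (x * y + y * x) * (x * y + y * x)
    = (x * x + y * y) * (x * x + y * y) by ring.
by rewrite e; field; rewrite n0.
Qed.

Lemma is_cderive_horner (q : {poly C}) f t a :
  is_cderive f t a -> is_cderive (fun t => q.[f t]) t (q^`().[f t] * a).
Proof.
move=> fd; elim/poly_ind: q => [|q c qd].
  have -> : (fun s => 0.[f s]) = (fun=> 0) by apply/funext => s; rewrite horner0.
  by rewrite deriv0 horner0 mul0r; exact: is_cderive_cst.
have := is_cderiveD (is_cderiveM qd fd) (is_cderive_cst c t).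
rewrite (_ : (fun t => _) = (fun t => (q * 'X + c%:P).[f t])); last first.
  by apply/funext => s; rewrite hornerMXaddC.
congr is_cderive; rewrite derivD derivC derivM derivX !hornerE.
by ring.
Qed.

Lemma within01_integrable (p : R -> R) : {within `[0, 1], continuous p} ->
  lebesgue_measure.-integrable `[0, 1] (EFin \o p).
Proof. by apply: continuous_compact_integrable; exact: segment_compact. Qed.

(** Agreement on the open interval suffices, as the endpoints are negligible;
this absorbs the values of [arc_deriv] at 0 and 1. *)
Lemma eq_cintegral01 f g : ccont01 g -> (forall t, t \in `]0, 1[ -> f t = g t) ->
  cintegral01 f = cintegral01 g.
Proof.
have itv (p q : R -> R) : {within `[0, 1], continuous q} ->
    (forall t, t \in `]0, 1[ -> p t = q t) ->
    Rintegral lebesgue_measure `[0, 1] p = Rintegral lebesgue_measure `[0, 1] q.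
  move=> qc pq; rewrite /Rintegral; congr fine.
  have mq : @measurable_fun _ _ (measurableTypeR R) (measurableTypeR R) `]0, 1[ q.
    have : @measurable_fun _ _ (measurableTypeR R) (measurableTypeR R) `[0, 1] q.
      exact: subspace_continuous_measurable_fun.
    by apply: measurable_funS => //; exact: subset_itv_oo_cc.
  have mp : @measurable_fun _ _ (measurableTypeR R) (measurableTypeR R) `]0, 1[ p.
    by apply: eq_measurable_fun mq => t /set_mem t01; rewrite pq.
  rewrite !(@integral_itv_bndoo R 0 1 _ true false) //; try exact/measurable_EFinP.
  by apply: eq_integral => t /set_mem t01; rewrite pq.
move=> [gr gi] fg; rewrite /cintegral01.
by congr (_ +i* _)%C; apply: itv => // t /fg ->.
Qed.

Lemma cintegral01D f g : ccont01 f -> ccont01 g ->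
  cintegral01 (fun t => f t + g t) = cintegral01 f + cintegral01 g.
Proof.
have int := within01_integrable.
move=> [fr fi] [gr gi]; rewrite /cintegral01 -[RHS]/(_ +i* _)%C.
have eD (P : {additive C -> R}) : {within `[0, 1], continuous (P \o f)} ->
   {within `[0, 1], continuous (P \o g)} ->
   Rintegral lebesgue_measure `[0, 1] (fun t => P (f t + g t)) =
   Rintegral lebesgue_measure `[0, 1] (fun t => P (f t)) +
   Rintegral lebesgue_measure `[0, 1] (fun t => P (g t)).
  move=> fc gc; rewrite -RintegralD //; [|exact: int..].
  by apply: eq_Rintegral => t _; rewrite raddfD.
by congr (_ +i* _)%C; apply: eD.
Qed.

Lemma cintegral01Z c f : ccont01 f ->
  cintegral01 (fun t => c * f t) = c * cintegral01 f.
Proof.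
have int := within01_integrable.
have mZ (p : R -> R) (x : R) : {within `[0, 1], continuous p} ->
    {within `[0, 1], continuous (fun t => x * p t)}.
  by move=> pc y; apply: cvgM; [exact: cvg_cst|exact: pc].
move=> [fr fi]; case: c => a b.
rewrite /cintegral01 -[RHS]/((_ - _) +i* (_ + _))%C.
rewrite -!RintegralZl //; try exact: int.
rewrite -RintegralB //; try exact/int/mZ.
rewrite -RintegralD //; try exact/int/mZ.
by congr (_ +i* _)%C; apply: eq_Rintegral => t _; rewrite ?ReM ?ImM.
Qed.

Lemma cintegral01_FTC F f : ccont01 F -> ccont01 f ->
  (forall t, t \in `]0, 1[ -> is_cderive F t (f t)) ->
  cintegral01 f = F 1 - F 0.
Proof.
move=> [Fr Fi] [fr fi] Ff.
have FTC (P p : R -> R) : {within `[0, 1], continuous P} ->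
    {within `[0, 1], continuous p} ->
    (forall t, t \in `]0, 1[ -> is_derive t 1 P (p t)) ->
    Rintegral lebesgue_measure `[0, 1] p = P 1 - P 0.
  move=> Pc pc Pp; rewrite /Rintegral (@continuous_FTC2 _ _ P) //.
    have /(continuous_within_itvP _ ltr01) [_ P0 P1] := Pc.
    by split=> // t /Pp [].
  by move=> t /Pp Pt; rewrite derive1E derive_val.
have -> : F 1 - F 0 = ((Re (F 1) - Re (F 0)) +i* (Im (F 1) - Im (F 0)))%C.
  by case: (F 1) => a b; case: (F 0).
congr (_ +i* _)%C.
  by apply: (FTC (fun t => Re (F t))) => // t /Ff[].
by apply: (FTC (fun t => Im (F t))) => // t /Ff[].
Qed.

End ComplexValued.

(** * Contour integrals of rational functions *)

Section ContourIntegral.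
Local Open Scope classical_set_scope.
Local Open Scope ring_scope.
Variable R : realType.
Local Notation C := R[i].
Implicit Types (g : R -> C) (h : C -> C) (G : seq (R -> C)) (p q r : {poly C}).

Lemma C1_arcP g : C1_arc g -> ccont01 g /\
  exists2 dg, ccont01 dg & forall t, t \in `]0, 1[ -> is_cderive g t (dg t).
Proof.
move=> [[rc [dr drc rd]] [ic [di dic id]]]; split; first by split.
exists (fun t => (dr t +i* di t)%C); first by split.
by move=> t t01; split; [exact: rd|exact: id].
Qed.

Lemma arc_derivE g t c : is_cderive g t c -> arc_deriv g t = c.
Proof.
case: c => a b [/= da db].
by rewrite /arc_deriv !derive1E !derive_val.
Qed.

Definition contour_cont G h := forall g, g \in G -> ccont01 (fun t => h (g t)).

Lemma eq_contour_integral G h k : (forall z, on_contour G z -> h z = k z) ->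
  contour_integral G h = contour_integral G k.
Proof.
move=> hk; rewrite /contour_integral big_seq [RHS]big_seq.
apply: eq_bigr => g gG; congr (_ +i* _)%C;
  by apply: eq_Rintegral => t /set_mem t01; rewrite hk //; exists g => //; exists t.
Qed.

Section ClosedContour.
Variable G : seq (R -> C).
Hypothesis closedG : closed_contour G.

Let arcG g : g \in G -> C1_arc g. Proof. by case: closedG => + _; apply. Qed.

Lemma contour_integralD h k : contour_cont G h -> contour_cont G k ->
  contour_integral G (fun z => h z + k z) =
  contour_integral G h + contour_integral G k.
Proof.
move=> hc kc; rewrite /contour_integral -big_split /= big_seq [RHS]big_seq.
apply: eq_bigr => g gG; have [_ [dg dgc gd]] := C1_arcP (arcG gG).
have hgc := ccont01M (hc _ gG) dgc; have kgc := ccont01M (kc _ gG) dgc.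
rewrite [X in _ = X + _](eq_cintegral01 hgc) => [|t t01]; last first.
  by rewrite (arc_derivE (gd t t01)).
rewrite [X in _ = _ + X](eq_cintegral01 kgc) => [|t t01]; last first.
  by rewrite (arc_derivE (gd t t01)).
rewrite -cintegral01D //; apply: eq_cintegral01 => [|t t01].
  exact: ccont01D.
by rewrite (arc_derivE (gd t t01)) mulrDl.
Qed.

Lemma contour_integralZ c h : contour_cont G h ->
  contour_integral G (fun z => c * h z) = c * contour_integral G h.
Proof.
move=> hc; rewrite /contour_integral mulr_sumr /= big_seq [RHS]big_seq.
apply: eq_bigr => g gG; have [_ [dg dgc gd]] := C1_arcP (arcG gG).
have hgc := ccont01M (hc _ gG) dgc.
rewrite [X in _ = _ * X](eq_cintegral01 hgc) => [|t t01]; last first.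
  by rewrite (arc_derivE (gd t t01)).
rewrite -cintegral01Z //; apply: eq_cintegral01 => [|t t01].
  exact: ccont01M (ccont01_cst c) hgc.
by rewrite (arc_derivE (gd t t01)) mulrA.
Qed.

(** The end of each arc cancels the beginning of the cyclically next one. *)
Lemma contour_telescope (F : C -> C) : \sum_(g <- G) (F (g 1) - F (g 0)) = 0.
Proof.
case: closedG => _; case: G => [|g0 s] /=; first by rewrite big_nil.
suff path_sum g : path (fun g g' => g 1 == g' 0) g (rcons s g0) ->
    \sum_(g' <- rcons s g0) (F (g' 1) - F (g' 0)) = F (g0 1) - F (g 1).
  by move=> /path_sum; rewrite subrr -cats1 big_cat /= big_seq1 addrC big_cons.
elim: s g => [|g' s IHs] g /= /andP[/eqP gh].
  by rewrite big_seq1 gh.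
by move=> /IHs E; rewrite big_cons E gh addrC addrA subrK.
Qed.

Lemma contour_integral_primitive F h : contour_cont G F -> contour_cont G h ->
  (forall g t a, g \in G -> t \in `]0, 1[ -> is_cderive g t a ->
     is_cderive (fun t => F (g t)) t (h (g t) * a)) ->
  contour_integral G h = 0.
Proof.
move=> Fc hc Fh; rewrite -(contour_telescope F) /contour_integral.
rewrite big_seq [RHS]big_seq.
apply: eq_bigr => g gG; have [_ [dg dgc gd]] := C1_arcP (arcG gG).
have hgc := ccont01M (hc _ gG) dgc.
rewrite (eq_cintegral01 hgc) => [|t t01]; last by rewrite (arc_derivE (gd t t01)).
apply: (cintegral01_FTC (Fc _ gG)) => // t t01.
by apply: Fh => //; exact: gd.
Qed.

Lemma contour_cont_horner q : contour_cont G (fun z => q.[z]).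
Proof. by move=> g /arcG /C1_arcP[gc _]; exact: ccont01_horner. Qed.

Definition avoids q := forall z, root q z -> ~ on_contour G z.

Lemma avoids1 : avoids 1.
Proof. by move=> z; rewrite rootC oner_eq0. Qed.

Lemma avoidsM q r : avoids q -> avoids r -> avoids (q * r).
Proof. by move=> qa ra z; rewrite rootM => /orP[/qa|/ra]. Qed.

Lemma avoidsX q k : avoids q -> avoids (q ^+ k).
Proof.
by move=> qa; elim: k => [|k]; [exact: avoids1|rewrite exprS; exact: avoidsM].
Qed.

Lemma avoids_XsubC a : ~ on_contour G a -> avoids ('X - a%:P).
Proof. by move=> aG z; rewrite root_XsubC => /eqP ->. Qed.

Lemma avoids_neq0 q g t : avoids q -> g \in G -> t \in `[0, 1] -> q.[g t] != 0.
Proof. by move=> qa gG t01; apply/negP => /qa; apply; exists g => //; exists t. Qed.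

Lemma contour_cont_ratio q r : avoids r -> contour_cont G (fun z => q.[z] / r.[z]).
Proof.
move=> ra g gG; apply: ccont01M; first exact: contour_cont_horner.
by apply: ccont01V => [t t01|]; [exact: avoids_neq0|exact: contour_cont_horner].
Qed.

Definition ratio_integral q r := contour_integral G (fun z => q.[z] / r.[z]).

Lemma ratio_integralD q1 q2 r : avoids r ->
  ratio_integral (q1 + q2) r = ratio_integral q1 r + ratio_integral q2 r.
Proof.
move=> ra; rewrite -contour_integralD; try exact: contour_cont_ratio.
by apply: eq_contour_integral => z _; rewrite hornerD mulrDl.
Qed.

Lemma ratio_integralZ c q r : avoids r ->
  ratio_integral (c *: q) r = c * ratio_integral q r.
Proof.
move=> ra; rewrite -contour_integralZ; last exact: contour_cont_ratio.
by apply: eq_contour_integral => z _; rewrite hornerZ mulrA.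
Qed.

Lemma ratio_integral_cancel p q r : avoids p ->
  ratio_integral (p * q) (p * r) = ratio_integral q r.
Proof.
move=> pa; apply: eq_contour_integral => z zG; rewrite !hornerM.
have pz0 : p.[z] != 0 by apply/negP => /pa.
by rewrite invfM mulrACA mulfV // mul1r.
Qed.

Lemma ratio_integral1 q : ratio_integral q 1 = 0.
Proof.
have [p pq] := poly_primitive q.
apply: (@contour_integral_primitive (fun z => p.[z])).
- exact: contour_cont_horner.
- exact/contour_cont_ratio/avoids1.
by move=> g t a _ _ /is_cderive_horner; rewrite -pq hornerC divr1; apply.
Qed.

(** Poles of order at least 2 have a rational primitive, here a polynomial in
(z - a)^-1. *)
Lemma ratio_integral_pole a k : ~ on_contour G a ->
  ratio_integral 1 (('X - a%:P) ^+ k.+2) = 0.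
Proof.
move=> aG; have da : avoids ('X - a%:P) by exact: avoids_XsubC.
pose p : {poly C} := - k.+1%:R^-1 *: 'X^(k.+1).
pose F z := p.[('X - a%:P).[z]^-1].
apply: (@contour_integral_primitive F).
- move=> g gG; apply: ccont01_horner; apply: ccont01V.
    by move=> t t01; exact: avoids_neq0.
  exact: contour_cont_horner.
- by apply: contour_cont_ratio; exact: avoidsX.
move=> g t c gG t01 gd.
have n0 : ('X - a%:P).[g t] != 0.
  by apply: avoids_neq0 => //; exact: subset_itv_oo_cc t01.
have := is_cderive_horner p (is_cderiveV n0 (is_cderive_horner ('X - a%:P) gd)).
congr is_cderive; rewrite /p derivZ derivXn derivXsubC !hornerE.
rewrite hornerMn !hornerE /=; set x := g t - a.
rewrite exprVn -[x ^- k *+ _]mulr_natr (exprSr x k.+1) (exprSr x k).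
have x0 : x != 0 by move: n0; rewrite hornerXsubC.
have xk0 : x ^+ k != 0 by rewrite expf_neq0.
have k0 : (k.+1%:R : C) != 0 by rewrite pnatr_eq0.
by field; rewrite x0 xk0 -natr1 addrC in k0 *.
Qed.

Lemma two_pi_i_neq0 : two_pi_i R != 0.
Proof.
rewrite mulf_neq0 ?eq_complex //= ?oner_eq0 ?andbF //.
by rewrite eqxx andbT mulf_neq0 ?pnatr_eq0 // gt_eqF // pi_gt0.
Qed.

Lemma winding_numberE a :
  ratio_integral 1 ('X - a%:P) = two_pi_i R * winding_number G a.
Proof.
rewrite /winding_number mulrA mulfV ?two_pi_i_neq0 // mul1r.
by apply: eq_contour_integral => z _; rewrite hornerC hornerXsubC mul1r.
Qed.

Lemma ratio_integral_XsubC q a : ~ on_contour G a ->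
  ratio_integral q ('X - a%:P) = q.[a] * (two_pi_i R * winding_number G a).
Proof.
move=> aG; have da := avoids_XsubC aG; have [p {1}->] := poly_XsubC_eq q a.
rewrite ratio_integralD // -{2}['X - _]mulr1 ratio_integral_cancel //.
rewrite ratio_integral1 add0r -winding_numberE -ratio_integralZ //.
by rewrite alg_polyC.
Qed.

Definition outside q := forall z, root q z -> ~ on_contour G z /\ ~ inside G z.

Lemma outside_avoids q : outside q -> avoids q.
Proof. by move=> qo z /qo []. Qed.

Lemma ratio_integral_XsubCX q a k : ~ on_contour G a -> ~ inside G a ->
  ratio_integral q (('X - a%:P) ^+ k) = 0.
Proof.
move=> aG ia; have wa : winding_number G a = 0.
  by apply: contrapT => /eqP wa; apply: ia.
have da := avoids_XsubC aG; elim: k q => [|k IHk] q; first exact: ratio_integral1.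
have [p ->] := poly_XsubC_eq q a.
rewrite ratio_integralD; last exact: avoidsX.
rewrite {1}exprS ratio_integral_cancel // IHk add0r.
rewrite -alg_polyC ratio_integralZ; last exact: avoidsX.
case: k {IHk} => [|k]; last by rewrite ratio_integral_pole // mulr0.
by rewrite expr1 winding_numberE wa !mulr0.
Qed.

(** One step of a partial fraction decomposition. *)
Lemma ratio_integral_split q r1 r2 u1 u2 : avoids r1 -> avoids r2 ->
  u1 * r1 + u2 * r2 = 1 ->
  ratio_integral q (r1 * r2) =
    ratio_integral (q * u1) r2 + ratio_integral (q * u2) r1.
Proof.
move=> a1 a2 e; rewrite -[q in LHS]mulr1 -e mulrDr.
rewrite ratio_integralD; last exact: avoidsM.
rewrite mulrA [_ * r1]mulrC ratio_integral_cancel //.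
by rewrite [r1 * r2]mulrC mulrA [_ * r2]mulrC ratio_integral_cancel.
Qed.

(** Cauchy's theorem for rational functions: by partial fractions the integrand
is a sum of a polynomial and of polar parts, all of which have primitives except
the simple poles, and these have winding number zero. *)
Lemma ratio_integral_outside q r : r != 0 -> outside r -> ratio_integral q r = 0.
Proof.
(* Induction on the size of r, splitting off one root with its multiplicity. *)
have [n] := ubnP (size r); elim: n => // n IHn in q r *.
move=> le_rn r0 ro; have [r1|r1] := boolP (size r == 1)%N.
  have /size_poly1P[c c0 rE] := r1.
  rewrite rE -[c%:P]mulr1 -[q](scalerKV c0) -mul_polyC.
  rewrite ratio_integral_cancel ?ratio_integral1 // => z.
  by rewrite rootC (negPf c0).
have /closed_rootP[a ra] := r1.
have [[|k] [r' /= r'a rE]] := multiplicity_XsubC r a; rewrite r0 /= in r'a.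
  by move: r'a; rewrite rE mulr1 in ra; rewrite ra.
have [aG ia] := ro _ ra; have da := avoids_XsubC aG.
have r'o : outside r' by move=> z r'z; apply: ro; rewrite rE rootM r'z.
have [u1 [u2 e]] := bezout_root r'a k.+1.
rewrite rE (ratio_integral_split _ _ _ e) ?ratio_integral_XsubCX //; last 2 first.
- exact: outside_avoids.
- exact: avoidsX.
rewrite add0r IHn //.
  move: le_rn; rewrite rE size_Mmonic ?monic_exp ?monicXsubC //.
    by rewrite size_exp_XsubC; lia.
  by apply: contraNneq r0 => r'0; rewrite rE r'0 mul0r.
by apply: contraNneq r0 => r'0; rewrite rE r'0 mul0r.
Qed.

(** The residue theorem when a simple pole is the only pole inside. *)
Lemma ratio_integral_simple_pole q r a : ~ on_contour G a -> outside r ->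
  ~~ root r a ->
  ratio_integral q (r * ('X - a%:P)) =
    q.[a] / r.[a] * (two_pi_i R * winding_number G a).
Proof.
move=> aG ro ra; have [u1 [u2 e]] := bezout_root ra 1; rewrite expr1 in e.
have r0 : r != 0 by apply: contraNneq ra => ->; rewrite root0.
have da := avoids_XsubC aG.
rewrite (ratio_integral_split _ _ _ e) //; last exact: outside_avoids.
rewrite (ratio_integral_outside _ r0) // addr0 ratio_integral_XsubC //.
have /(congr1 (fun p => p.[a])) := e.
rewrite hornerD hornerM [(u2 * _).[a]]hornerM hornerXsubC subrr mulr0 addr0 hornerC.
move=> u1a; rewrite hornerM -[u1.[a]](mulfK ra) u1a mul1r.
by [].
Qed.

End ClosedContour.
End ContourIntegral.

(** * Residues at poles of maximal order *)

Section RationalFunctional.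
Variables (R : realType) (G : seq (R -> R[i])).
Local Notation C := R[i].
Hypothesis closedG : closed_contour G.

Variables (I : finType) (lam : I -> C) (mult : I -> nat) (N E : {poly C}).
Hypothesis inj_lam : injective lam.
Let D := \prod_i ('X - (lam i)%:P) ^+ mult i.
Hypothesis outE : outside G E.
Hypothesis insideD : forall i, inside G (lam i).
Hypothesis rootEN : forall i, ~~ root E (lam i).
Hypothesis rootNN : forall i, ~~ root N (lam i).

(** The form q, p |-> \oint q p N / (D E) has no kernel modulo D. If D does not
divide q, some factor ('X - lam i) has a smaller exponent k in q than in D.
Multiply q by the other factors of D and by the power of 'X - lam i that raises
k to mult i - 1: what remains has one enclosed pole, a simple one, and its
residue is nonzero because N and E do not vanish there. *)
Lemma ratio_integral_nondegenerate (q : {poly C}) : q != 0 -> (size q < size D)%N ->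
  exists p, ratio_integral G (q * p * N) (D * E) != 0.
Proof.
move=> q0 lt_qD; pose X i : {poly C} := 'X - (lam i)%:P.
have [i lt_i] : exists i, (mup (lam i) q < mult i)%N.
  apply/existsP; rewrite -[[exists _, _]]negbK negb_exists.
  apply: contraL lt_qD => /forallP le_mult; rewrite -leqNgt dvdp_leq //.
  apply: dvdp_prod_XsubCX => // [|i]; first exact: index_enum_uniq.
  by rewrite -mup_geq // leqNgt.
have [k [q' q'i qE]] := multiplicity_XsubC q (lam i); rewrite q0 /= in q'i.
have ki : (k < mult i)%N by rewrite qE mupMr // mup_XsubCX eqxx in lt_i.
pose Di := \prod_(j | j != i) X j ^+ mult j.
have iG : ~ on_contour G (lam i) by have [] := insideD i.
have avX j : avoids G (X j) by apply: avoids_XsubC; have [] := insideD j.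
have avDi : avoids G Di.
  rewrite /Di; elim/big_rec: _ => [|j r _ rG]; first exact: avoids1.
  by apply: avoidsM => //; exact: avoidsX.
exists (X i ^+ (mult i - k.+1) * Di).
have -> : q * (X i ^+ (mult i - k.+1) * Di) * N =
    (X i ^+ (mult i).-1 * Di) * (q' * N).
  rewrite qE (_ : (mult i).-1 = k + (mult i - k.+1))%N; last by lia.
  by rewrite exprD; ring.
have -> : D * E = (X i ^+ (mult i).-1 * Di) * (E * X i).
  rewrite /D (bigD1 i) //= -/(Di) -{1}(prednK (leq_ltn_trans (leq0n _) ki)) exprS.
  by rewrite /X /Di; ring.
rewrite ratio_integral_cancel; last by apply: avoidsM => //; exact: avoidsX.
rewrite ratio_integral_simple_pole //; apply: mulf_neq0; apply: mulf_neq0.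
- by rewrite hornerM mulf_neq0 //; exact: rootNN.
- by rewrite invr_eq0; exact: rootEN.
- exact: two_pi_i_neq0.
by have [] := insideD i.
Qed.

End RationalFunctional.

(** * The resolvent of a matrix polynomial *)

Section Resolvent.
Local Open Scope sesquilinear_scope.
Variables (R : realType) (n l : nat) (A : 'I_l.+1 -> 'M[R[i]]_n).
Variables (u v : 'cV[R[i]]_n).
Local Notation C := R[i].
Local Notation d := (\det (mxpol A)).

(** Numerator of the resolvent function over the denominator \det P, by Cramer's
rule. *)
Definition resolvent_num : {poly C} :=
  (map_mx polyC (u^t*) *m \adj (mxpol A) *m map_mx polyC v) 0 0.

Lemma mxpol_horner z : map_mx (horner_eval z) (mxpol A) = mxpol_eval A z.
Proof.
rewrite /mxpol raddf_sum; apply: eq_bigr => j _ /=.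
apply/matrixP => a b; rewrite !mxE /horner_eval hornerM hornerXn hornerC.
by [].
Qed.

Lemma det_mxpol_eval z : \det (mxpol_eval A z) = d.[z].
Proof. by rewrite -mxpol_horner det_map_mx. Qed.

Lemma map_polyC_horner m1 m2 (B : 'M[C]_(m1, m2)) z :
  map_mx (horner_eval z) (map_mx polyC B) = B.
Proof. by apply/matrixP => a b; rewrite !mxE /horner_eval hornerC. Qed.

Lemma resolvent_numE z :
  resolvent_num.[z] = (u^t* *m \adj (mxpol_eval A z) *m v) 0 0.
Proof.
have -> : resolvent_num.[z] = map_mx (horner_eval z)
    (map_mx polyC (u^t*) *m \adj (mxpol A) *m map_mx polyC v) 0 0 by rewrite mxE.
by rewrite !map_mxM /= map_mx_adj !map_polyC_horner mxpol_horner.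
Qed.

Lemma resolvent_funE z : ~~ root d z ->
  resolvent_fun A u v z = resolvent_num.[z] / d.[z].
Proof.
rewrite rootE => dz; rewrite /resolvent_fun /invmx unitmxE unitfE det_mxpol_eval dz.
by rewrite -scalemxAr -scalemxAl mxE resolvent_numE mulrC.
Qed.

(** If w kills M + v u^*, applying the equation to a right eigenvector x gives
(w v) (u^* x) = 0, so w v = 0. Then w is a left eigenvector orthogonal to v. *)
Lemma generic_bordered_unit z : root d z -> generic_at A u v z ->
  mxpol_eval A z + v *m u^t* \in unitmx.
Proof.
set M := mxpol_eval A z; rewrite rootE -det_mxpol_eval => /eqP dz [ux yv].
have [x x0 Mx] : exists2 x : 'cV[C]_n, x != 0 & M *m x = 0.
  have : kermx M^T != 0.
    by rewrite kermx_eq0 row_free_unit unitmx_tr unitmxE dz unitr0.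
  case/rowV0Pn => w /sub_kermxP wM w0; exists w^T.
    by apply: contra_neq w0 => /(congr1 trmx); rewrite trmxK trmx0.
  by apply: trmx_inj; rewrite trmx_mul trmxK wM trmx0.
rewrite -row_free_unit -kermx_eq0; apply/rowV0P => w /sub_kermxP.
rewrite mulmxDr mulmxA => wM; apply/eqP/contraT => w0.
have ux0 : (u^t* *m x) 0 0 != 0.
  by apply: contra_neq (ux x x0 Mx) => e; rewrite [LHS]mx11_scalar e raddf0.
have := congr1 (fun B => B *m x) wM.
rewrite mulmxDl -!mulmxA Mx mulmx0 add0r mul0mx mulmxA.
rewrite [w *m v]mx11_scalar [u^t* *m x]mx11_scalar -scalar_mxM.
move/(congr1 (fun B : 'M[C]_1 => B 0 0)); rewrite [LHS]mxE [RHS]mxE mulr1n => /eqP.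
rewrite mulf_eq0 (negPf ux0) orbF => /eqP wv0.
have wv : w *m v = 0 by rewrite [LHS]mx11_scalar wv0 raddf0.
have wE : (w^t*)^t* = w by rewrite trmxCK.
have y0 : w^t* != 0.
  by apply: contra_neq w0 => e; rewrite -wE e trmx0 map_mx0.
have := yv _ y0; rewrite wE wv eqxx; apply.
by move: wM; rewrite wv mul0mx addr0.
Qed.

(** The identity det (P + v u^* ) = det P + resolvent_num holds over polynomials,
where det P is nonzero; at an eigenvalue its right-hand side is the value of
the numerator, and its left-hand side is nonzero. *)
Lemma resolvent_num_neq0 z : d != 0 -> root d z -> generic_at A u v z ->
  ~~ root resolvent_num z.
Proof.
move=> d0 dz /(generic_bordered_unit dz).
have := det_rank1_update (map_mx polyC v) (map_mx polyC (u^t*)) d0.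
move=> /(congr1 (horner_eval z)); rewrite -det_map_mx map_mxD map_mxM.
rewrite !map_polyC_horner mxpol_horner /horner_eval hornerD.
by rewrite (rootP dz) add0r unitmxE unitfE rootE => ->.
Qed.

End Resolvent.

Lemma mxpol_pencil (R : realType) m (H1 H0 : 'M[R[i]]_m) :
  mxpol (pencil H1 H0) = map_mx polyC H1 - 'X *: map_mx polyC H0.
Proof.
rewrite /mxpol big_ord_recl big_ord1 /pencil /= expr0 scale1r expr1.
by rewrite map_mxN scalerN.
Qed.

(** * The theorem *)

Theorem theorem5 (R : realType) (n l : nat) (A : 'I_l.+1 -> 'M[R[i]]_n)
    (G : seq (R -> R[i])) (u v : 'cV[R[i]]_n)
    (s : nat) (lam : 'I_s.+1 -> R[i]) (mult : 'I_s.+1 -> nat) (m : nat)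
    (hlead : A ord_max != 0)
    (hreg : mxpol_regular A)
    (hG : closed_contour G)
    (hlam_inj : injective lam)
    (hlam : forall z : R[i],
       (mxpol_eigenvalue A z /\ inside G z) <-> (exists i, z = lam i))
    (hmult : forall i, alg_mult A (lam i) = mult i)
    (hm : m = (\sum_(i < s.+1) mult i)%N)
    (hoff : forall z : R[i], mxpol_eigenvalue A z -> ~ on_contour G z)
    (hgeom : forall i, geom_mult A (lam i) = 1%N)
    (hgen : forall i, generic_at A u v (lam i)) :
  let H0 := hankel0 A u v G m in
  let H1 := hankel1 A u v G m in
  H0 \in unitmx /\
  (forall z : R[i], mxpol_eigenvalue (pencil H1 H0) z <-> (exists i, z = lam i)) /\
  (forall i, alg_mult (pencil H1 H0) (lam i) = mult i).
Proof.
set d := \det (mxpol A) in hreg *.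
pose N := resolvent_num A u v.
pose D := \prod_i ('X - (lam i)%:P) ^+ mult i.
have lamP i : root d (lam i) /\ inside G (lam i).
  by apply/hlam; exists i.
have [E dE] : exists E, d = D * E.
  have /dvdpP[E dE] : D %| d.
    apply: dvdp_prod_XsubCX => // [|i]; first exact: index_enum_uniq.
    by rewrite -mup_geq // -hmult.
  by exists E; rewrite dE mulrC.
have /norP[D0 E0] : ~~ ((D == 0) || (E == 0)) by rewrite -mulf_eq0 -dE.
have nrootE i : ~~ root E (lam i).
  have := hmult i; rewrite /alg_mult -/d dE mupM // mup_prod_XsubCX //.
  rewrite -dvdp_XsubCl XsubC_dvd // -eqn0Ngt => /eqP.
  by rewrite -[X in _ == X]addn0 eqn_add2l.
(* A root of E is an eigenvalue; an enclosed one would be some lam i. *)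
have outE : outside G E.
  move=> z Ez; have dz : root d z by rewrite dE rootM Ez orbT.
  split; first exact: hoff.
  move=> zG; have [i zi] : exists i, z = lam i by apply/hlam.
  by move: Ez; rewrite zi (negPf (nrootE i)).
have avd : avoids G d by move=> z; exact: hoff.
pose L0 p := (two_pi_i R)^-1 * ratio_integral G (p * N) d.
have L0_linear : GRing.linear_for *%R L0.
  move=> c p q; rewrite /L0 mulrDl -scalerAl ratio_integralD //.
  by rewrite ratio_integralZ // mulrDr mulrCA.
pose L : {scalar {poly R[i]}} :=
  HB.pack L0 (GRing.isLinear.Build _ _ _ _ L0 L0_linear).
have momentE k : moment A u v G k = L 'X^k.
  rewrite /moment; congr (_ * _); apply: eq_contour_integral => z zG.
  rewrite resolvent_funE; last by apply/negP => /hoff.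
  by rewrite mulrA hornerM hornerXn.
have monicD : D \is monic.
  by apply: monic_prod => i _; rewrite monic_exp // monicXsubC.
have LD0 p : L (D * p) = 0.
  rewrite -[LHS]/(L0 _) /L0 dE -mulrA ratio_integral_cancel.
    by rewrite ratio_integral_outside // mulr0.
  by move=> z Dz; apply: hoff; rewrite /mxpol_eigenvalue -/d dE rootM Dz.
(* The matrices of size m and of size (size D).-1 are identified by subst, the
   latter being the size of the companion matrix of D. *)
have mE : m = (size D).-1.
  rewrite hm size_prod => [|i _]; last by rewrite expf_neq0 // polyXsubC_eq0.
  under [in RHS]eq_bigr => i _ do rewrite size_exp_XsubC -addn1.
  by rewrite big_split /= sum1_card -addSn addnK.
move=> H0 H1; clear hm; subst m.
have H0E : H0 = \matrix_(i, j) L 'X^(i + j).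
  by apply/matrixP => i j; rewrite !mxE momentE.
have H1E : H1 = \matrix_(i, j) L 'X^((i + j).+1).
  by apply/matrixP => i j; rewrite !mxE momentE.
have H0u : H0 \in unitmx.
  rewrite H0E; apply: (hankel_unit monicD LD0) => q q0 le_qD.
  have lt_qD : (size q < size D)%N.
    by rewrite -(prednK (_ : 0 < size D)%N) ?size_poly_gt0.
  have inD i : inside G (lam i) by have [] := lamP i.
  have nrootN i : ~~ root N (lam i).
    by have [di _] := lamP i; exact: resolvent_num_neq0.
  have [p pP] :=
    ratio_integral_nondegenerate hG hlam_inj outE inD nrootE nrootN q0 lt_qD.
  by exists p; rewrite -[L _]/(L0 _) /L0 mulf_neq0 ?invr_eq0 ?two_pi_i_neq0 // dE.
have detE : \det (mxpol (pencil H1 H0)) =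
    ((-1) ^+ (size D).-1 * \det H0) *: D.
  by rewrite mxpol_pencil H0E H1E det_hankel_pencil.
have c0 : (-1) ^+ (size D).-1 * \det H0 != 0.
  by rewrite mulf_neq0 ?expf_neq0 ?oppr_eq0 ?oner_eq0 // -unitfE -unitmxE.
split=> //; split=> [z|i].
  rewrite /mxpol_eigenvalue detE rootZ //; split=> [|[i ->]].
    rewrite rootE horner_prod => /prodf_eq0[i _].
    rewrite horner_exp hornerXsubC expf_eq0 subr_eq0 => /andP[_ /eqP ->].
    by exists i.
  have [di _] := lamP i.
  rewrite -dvdp_XsubCl XsubC_dvd // mup_prod_XsubCX // -hmult /alg_mult -/d.
  by rewrite -XsubC_dvd // dvdp_XsubCl.
by rewrite /alg_mult detE -mul_polyC mupMr ?rootC // mup_prod_XsubCX.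
Qed.
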